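(* Let $(M,\phi,\xi,\eta,g)$ be an almost $\alpha$-cosymplectic $3$-manifold admitting a contact Einstein soliton, i.e. there is a constant $\lambda\in\mathbb{R}$ with $\mathfrak{L}_\xi g+2S=(2\lambda+r)g$. Let $(e,\phi e,\xi)$ be a local $\phi$-basis with $he=\sigma e$, and let $a=g(\nabla_e\phi e,e)$, $b=-g(\nabla_{\phi e}e,\phi e)$. Then the soliton is: (1) steady ($\lambda=0$), if $\alpha^2=\sigma^2-(a^2+b^2)-(\phi e)(a)+e(b)$; (2) shrinking ($\lambda>0$), if $\alpha^2>\sigma^2-(a^2+b^2)-(\phi e)(a)+e(b)$; (3) expanding ($\lambda<0$), if $\alpha^2<\sigma^2-(a^2+b^2)-(\phi e)(a)+e(b)$.
   Context: An almost contact metric manifold $(M^{2n+1},\phi,\xi,\eta,g)$ is a Riemannian manifold $(M,g)$ with a $(1,1)$-tensor $\phi$, a global vector field $\xi$ (the characteristic or Reeb vector field) and a $1$-form $\eta$ such that $\phi^2X=-X+\eta(X)\xi$, $\eta(\xi)=1$ and $g(\phi X,\phi Y)=g(X,Y)-\eta(X)\eta(Y)$ for all vector fields $X,Y$. Put $\Phi(X,Y)=g(\phi X,Y)$. It is an almost $\alpha$-cosymplectic manifold if $d\eta=0$ and $d\Phi=2\alpha\,\eta\wedge\Phi$ for a constant $\alpha\in\mathbb{R}$. Put $h=\frac12\mathfrak{L}_\xi\phi$, where $\mathfrak{L}$ denotes the Lie derivative. In dimension $3$ a $\phi$-basis is a local orthonormal frame $(e,\phi e,\xi)$ with $he=\sigma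 e$, $h\phi e=-\sigma\phi e$, $h\xi=0$, where $\sigma$ is a local smooth eigenfunction of $h$. $\nabla$ is the Levi-Civita connection, $S$ the Ricci tensor, and $r$ the scalar curvature. An Einstein soliton with potential vector field $V$ is a solution of $\mathfrak{L}_Vg+2S=(2\lambda+r)g$ with $\lambda\in\mathbb{R}$ constant; it is steady if $\lambda=0$, shrinking if $\lambda>0$, expanding if $\lambda<0$. On an almost contact metric manifold it is called a contact Einstein soliton if $V=\xi$. For a vector field $X$ and a function $f$, $X(f)$ is the derivative of $f$ along $X$. *)

(* Defs.v *)
From HB Require Import structures.
From mathcomp Require Import all_boot all_order all_algebra.
From mathcomp Require Import all_classical all_reals all_analysis.

Set Implicit Arguments.
Unset Strict Implicit.
Unset Printing Implicit Defensive.

Import Order.TTheory GRing.Theory Num.Theory.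
Import numFieldNormedType.Exports.
Local Open Scope classical_set_scope.
Local Open Scope ring_scope.

Section SmoothMaps.
Variables (R : realType) (E F : normedModType R).

Fixpoint times_differentiable (k : nat) (V : set E) (f : E -> F) : Prop :=
  if k is k'.+1 then
    (forall x, V x -> differentiable f x) /\
    (forall v, times_differentiable k' V (fun x => 'D_v f x))
  else True.

(* C^oo on V, as infinite differentiability.  V is meant to be open; only the
   values of f on V matter. *)
Definition smooth_on (V : set E) (f : E -> F) : Prop :=
  forall k, times_differentiable k V f.

End SmoothMaps.

(* cinv is the inverse of the chart map; cmap and cinv are junk outside cdom
   and cmap @` cdom respectively. *)
Record chart (R : realType) (M : topologicalType) (m : nat) := Chart {
  cdom : set M;
  cmap : M -> 'rV[R]_m;
  cinv : 'rV[R]_m -> M }.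

Section Manifold.
Variables (R : realType) (M : topologicalType) (m : nat).
Implicit Types (A : set (chart R M m)) (U V : set M) (f : M -> R) (p : M).

Record is_chart (c : chart R M m) : Prop := IsChart {
  chart_dom_open : open (cdom c);
  chart_img_open : open (cmap c @` cdom c);
  chart_mapK : forall p, cdom c p -> cinv c (cmap c p) = p;
  chart_map_cont : forall p, cdom c p -> {for p, continuous (cmap c)};
  chart_inv_cont : forall x, (cmap c @` cdom c) x ->
    {for x, continuous (cinv c)} }.

Record smooth_manifold A : Prop := SmoothManifold {
  mfd_hausdorff : hausdorff_space M;
  mfd_second_countable : @second_countable M;
  mfd_chart : forall c, A c -> is_chart c;
  mfd_cover : forall p, exists2 c, A c & cdom c p;
  mfd_compat : forall c c', A c -> A c' ->
    smooth_on (cmap c @` (cdom c `&` cdom c')) (cmap c' \o cinv c) }.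

Definition smooth_fun A U f : Prop :=
  forall c, A c -> smooth_on (cmap c @` (U `&` cdom c)) (f \o cinv c).

Definition smooth_near A p f : Prop :=
  exists2 V, open_nbhs p V & smooth_fun A V f.

(* Tangent vectors are functionals acting on functions smooth near p. They are
   normalised to vanish on all other functions, so that equality of functionals
   is equality of tangent vectors. *)
Definition vec : Type := (M -> R) -> R.

Definition dir_deriv A (c : chart R M m) p (w : 'rV[R]_m) : vec :=
  fun f => if `[< smooth_near A p f >]
           then 'D_w (f \o cinv c) (cmap c p) else 0.

(* The tangent space T_pM. By the chain rule "in every chart around p" is the
   same as "in some chart around p". *)
Definition tangent A p : set vec :=
  [set v | forall c, A c -> cdom c p -> exists w, v = dir_deriv A c p w].

(* Smooth vector field on the open set U; its values outside U are junk. *)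
Definition vfield A U (X : M -> vec) : Prop :=
  (forall p, U p -> tangent A p (X p)) /\
  (forall V f, open V -> V `<=` U -> smooth_fun A V f ->
     smooth_fun A V (fun p => X p f)).

Definition bracket A (X Y : M -> vec) : M -> vec :=
  fun p f => if `[< smooth_near A p f >]
             then X p (fun q => Y q f) - Y p (fun q => X q f) else 0.

Definition covector A p (w : vec -> R) : Prop :=
  forall a u v, tangent A p u -> tangent A p v ->
    w (a *: u + v) = a * w u + w v.

Record one_form A (w : M -> vec -> R) : Prop := OneForm {
  one_form_linear : forall p, covector A p (w p);
  one_form_smooth : forall U X, open U -> vfield A U X ->
    smooth_fun A U (fun p => w p (X p)) }.

Record tensor11 A (T : M -> vec -> vec) : Prop := Tensor11 {
  tensor11_tangent : forall p v, tangent A p v -> tangent A p (T p v);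
  tensor11_linear : forall p a u v, tangent A p u -> tangent A p v ->
    T p (a *: u + v) = a *: T p u + T p v;
  tensor11_smooth : forall U X, open U -> vfield A U X ->
    vfield A U (fun p => T p (X p)) }.

(* Exterior calculus, evaluated on vector fields. The normalisation is the one
   without 1/k! factors, for both d and the wedge product; with the other usual
   normalisation, both sides of  d Phi = 2 alpha eta /\ Phi  are divided by 3. *)
Definition d1 A (w : M -> vec -> R) (X Y : M -> vec) p : R :=
  X p (fun q => w q (Y q)) - Y p (fun q => w q (X q)) - w p (bracket A X Y p).

Definition d2 A (w : M -> vec -> vec -> R) (X Y Z : M -> vec) p : R :=
  X p (fun q => w q (Y q) (Z q)) - Y p (fun q => w q (X q) (Z q))
  + Z p (fun q => w q (X q) (Y q))
  - w p (bracket A X Y p) (Z p) + w p (bracket A X Z p) (Y p)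
  - w p (bracket A Y Z p) (X p).

Definition wedge12 (w : M -> vec -> R) (w' : M -> vec -> vec -> R) p
    (x y z : vec) : R :=
  w p x * w' p y z - w p y * w' p x z + w p z * w' p x y.

Record riemannian_metric A (g : M -> vec -> vec -> R) : Prop :=
  RiemannianMetric {
  metric_linear : forall p u, tangent A p u -> covector A p (g p u);
  metric_sym : forall p u v, tangent A p u -> tangent A p v ->
    g p u v = g p v u;
  metric_pos : forall p u, tangent A p u -> u != 0 -> 0 < g p u u;
  metric_smooth : forall U X Y, open U -> vfield A U X -> vfield A U Y ->
    smooth_fun A U (fun p => g p (X p) (Y p)) }.

(* nabla p v Y is the covariant derivative at p, in the direction v in T_pM, of
   a vector field Y defined near p. *)
Definition cov (nabla : M -> vec -> (M -> vec) -> vec) (X Y : M -> vec) :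
  M -> vec := fun p => nabla p (X p) Y.

Record connection A (nabla : M -> vec -> (M -> vec) -> vec) : Prop :=
  Connection {
  conn_smooth : forall U X Y, open U -> vfield A U X -> vfield A U Y ->
    vfield A U (cov nabla X Y);
  conn_local : forall U p v Y Z, open U -> U p -> tangent A p v ->
    vfield A U Y -> vfield A U Z -> (forall q, U q -> Y q = Z q) ->
    nabla p v Y = nabla p v Z;
  conn_linear : forall U p a u v Y, open U -> U p ->
    tangent A p u -> tangent A p v -> vfield A U Y ->
    nabla p (a *: u + v) Y = a *: nabla p u Y + nabla p v Y;
  conn_add : forall U p v Y Z, open U -> U p -> tangent A p v ->
    vfield A U Y -> vfield A U Z ->
    nabla p v (fun q => Y q + Z q) = nabla p v Y + nabla p v Z;
  conn_leibniz : forall U p v f Y, open U -> U p -> tangent A p v ->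
    smooth_fun A U f -> vfield A U Y ->
    nabla p v (fun q => f q *: Y q) = v f *: Y p + f p *: nabla p v Y }.

Record levi_civita A (g : M -> vec -> vec -> R)
    (nabla : M -> vec -> (M -> vec) -> vec) : Prop := LeviCivita {
  lc_connection : connection A nabla;
  lc_torsion_free : forall U X Y p, open U -> vfield A U X -> vfield A U Y ->
    U p -> cov nabla X Y p - cov nabla Y X p = bracket A X Y p;
  lc_metric : forall U X Y Z p, open U -> vfield A U X -> vfield A U Y ->
    vfield A U Z -> U p ->
    X p (fun q => g q (Y q) (Z q))
      = g p (cov nabla X Y p) (Z p) + g p (Y p) (cov nabla X Z p) }.

Definition curvature A nabla (X Y Z : M -> vec) : M -> vec :=
  fun p => cov nabla X (cov nabla Y Z) p - cov nabla Y (cov nabla X Z) p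
           - cov nabla (bracket A X Y) Z p.

(* Some smooth vector field near p with value v at p. *)
Definition extension A p (v : vec) : M -> vec :=
  xget 0 [set X : M -> vec |
           X p = v /\ exists2 V, open_nbhs p V & vfield A V X].

(* R_p(u,v)w; by tensoriality the choice of the extensions is irrelevant. *)
Definition riemann A nabla p (u v w : vec) : vec :=
  curvature A nabla (extension A p u) (extension A p v) (extension A p w) p.

Definition orthonormal_basis A (g : M -> vec -> vec -> R) p
    (B : 'I_m -> vec) : Prop :=
  (forall i, tangent A p (B i)) /\
  (forall i j, g p (B i) (B j) = (i == j)%:R).

Definition onb A g p : 'I_m -> vec :=
  xget 0 [set B : 'I_m -> vec | orthonormal_basis A g p B].

(* S(u,v) is the trace of w |-> R(w,u)v (positive on round spheres). *)
Definition ricci A g nabla p (u v : vec) : R :=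
  \sum_(i < m) g p (riemann A nabla p (onb A g p i) u v) (onb A g p i).

Definition scalar_curvature A g nabla p : R :=
  \sum_(i < m) ricci A g nabla p (onb A g p i) (onb A g p i).

Definition lie_metric A (X : M -> vec) (g : M -> vec -> vec -> R)
    (Y Z : M -> vec) p : R :=
  X p (fun q => g q (Y q) (Z q))
  - g p (bracket A X Y p) (Z p) - g p (Y p) (bracket A X Z p).

Definition einstein_soliton A g nabla (W : M -> vec) (lambda : R) : Prop :=
  vfield A setT W /\
  forall U X Y p, open U -> vfield A U X -> vfield A U Y -> U p ->
    lie_metric A W g X Y p + 2 * ricci A g nabla p (X p) (Y p)
    = (2 * lambda + scalar_curvature A g nabla p) * g p (X p) (Y p).

Record almost_contact_metric A (phi : M -> vec -> vec) (xi : M -> vec)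
    (eta : M -> vec -> R) (g : M -> vec -> vec -> R) : Prop :=
  AlmostContactMetric {
  acm_metric : riemannian_metric A g;
  acm_phi : tensor11 A phi;
  acm_xi : vfield A setT xi;
  acm_eta : one_form A eta;
  acm_phi2 : forall p u, tangent A p u ->
    phi p (phi p u) = - u + eta p u *: xi p;
  acm_eta_xi : forall p, eta p (xi p) = 1;
  acm_compat : forall p u v, tangent A p u -> tangent A p v ->
    g p (phi p u) (phi p v) = g p u v - eta p u * eta p v }.

Definition fundamental_form (phi : M -> vec -> vec)
    (g : M -> vec -> vec -> R) : M -> vec -> vec -> R :=
  fun p u v => g p (phi p u) v.

Record almost_cosymplectic A phi xi eta g (alpha : R) : Prop :=
  AlmostCosymplectic {
  acs_contact : almost_contact_metric A phi xi eta g;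
  acs_eta : forall U X Y p, open U -> vfield A U X -> vfield A U Y -> U p ->
    d1 A eta X Y p = 0;
  acs_Phi : forall U X Y Z p, open U ->
    vfield A U X -> vfield A U Y -> vfield A U Z -> U p ->
    d2 A (fundamental_form phi g) X Y Z p
    = 2 * alpha * wedge12 eta (fundamental_form phi g) p (X p) (Y p) (Z p) }.

(* h = (1/2) L_xi phi, with (L_xi phi) X = [xi, phi X] - phi [xi, X]. *)
Definition h_tensor A (phi : M -> vec -> vec) (xi : M -> vec)
    (X : M -> vec) : M -> vec :=
  fun p => 2^-1 *: (bracket A xi (fun q => phi q (X q)) p
                    - phi p (bracket A xi X p)).

Record phi_basis A (phi : M -> vec -> vec) (xi : M -> vec)
    (g : M -> vec -> vec -> R) U (e : M -> vec) (sigma : M -> R) : Prop :=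
  PhiBasis {
  pb_field : vfield A U e;
  pb_sigma : smooth_fun A U sigma;
  pb_orthonormal : forall p, U p ->
    [/\ g p (e p) (e p) = 1,
        g p (phi p (e p)) (phi p (e p)) = 1,
        g p (xi p) (xi p) = 1 &
        [/\ g p (e p) (phi p (e p)) = 0, g p (e p) (xi p) = 0 &
            g p (phi p (e p)) (xi p) = 0]];
  pb_h : forall p, U p ->
    [/\ h_tensor A phi xi e p = sigma p *: e p,
        h_tensor A phi xi (fun q => phi q (e q)) p
          = - (sigma p *: phi p (e p)) &
        h_tensor A phi xi xi p = 0] }.

End Manifold.

(* Main.v *)
Require Import Defs.
From mathcomp Require Import all_boot all_order all_algebra.
From mathcomp Require Import all_classical all_reals all_analysis.
From mathcomp Require Import ring lra.
Import Order.TTheory GRing.Theory Num.Theory.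
Import numFieldNormedType.Exports.
Local Open Scope classical_set_scope.
Local Open Scope ring_scope.

(** The soliton constant is minus a sectional curvature: lambda = - K(e, phi e).
    Since xi is a unit field, (L_xi g)(xi, xi) = 0, so the soliton equation on
    the pair (xi, xi) reads 2 S(xi, xi) = 2 lambda + r.  In dimension 3 the
    numbers S(xi, xi) and r are K13 + K23 and 2 (K12 + K13 + K23), where Kij are
    the sectional curvatures of the planes spanned by an orthonormal frame with
    third vector xi, whence lambda = - K12 ([ricci_sub_scalar],
    [soliton_constant]).

    It remains to compute K12 in the frame (e, phi e, xi).  Closedness of eta
    makes the endomorphism nabla xi symmetric on the plane orthogonal to xi; the
    equation d Phi = 2 alpha eta /\ Phi fixes its trace, 2 alpha; and
    h e = sigma e says that its diagonal entries agree and that its off-diagonal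
    entry is - sigma ([cov_xi]).  The plane field orthogonal to xi is thus
    integrable, with second fundamental form of determinant alpha^2 - sigma^2,
    and its intrinsic curvature in terms of a and b is
    e(b) - (phi e)(a) - a^2 - b^2.  The Gauss equation, here a direct expansion
    in the frame, gives
      K12 = e(b) - (phi e)(a) - a^2 - b^2 - (alpha^2 - sigma^2)
    ([sectional_curvature]), so that lambda is the difference of the two sides
    compared in the theorem.

    The Ricci and scalar curvatures are defined by an arbitrary orthonormal
    basis of the tangent space and arbitrary extensions of its vectors to
    fields.  To compute them in the given frame one needs that the curvature is
    tensorial ([curvature_comb1], [curvature_comb2], [curvature_comb3],
    [riemannE]), that an orthonormal m-tuple spans the tangent space
    ([orthonormal_expansion]), and that traces are independent of the
    orthonormal basis ([trace_orthonormal]). *)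

Set Implicit Arguments.
Unset Strict Implicit.
Unset Printing Implicit Defensive.

(** * Infinitely differentiable maps *)

Section SmoothMaps.
Variables (R : realType) (E : normedModType R).

(** Differentiability only depends on the germ: the differential of [f] also
    satisfies the first-order expansion that characterises that of [g]. *)
Lemma near_eq_differentiable (F : normedModType R) (f g : E -> F) (x : E) :
  (\near x, f x = g x) -> differentiable f x -> differentiable g x.
Proof.
move=> fg /diff_locallyP[cdf /eqaddoP df].
have ggx : g \o shift x = cst (g x) + 'd f x +o_ 0 id.
  apply/eqaddoP => eps eps0.
  have fg0 : \forall y \near 0, f (y + x) = g (y + x).
    by move: fg; rewrite (near_shift 0 x) /= subr0; exact.
  move: (df eps eps0) fg0; apply: filterS2 => y + fgy.
  by rewrite !fctE /= fgy (nbhs_singleton fg).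
have dg : 'd g x = 'd f x :> (E -> F) by exact: diff_unique.
by apply/diff_locallyP; rewrite dg.
Qed.

(** Openness of [V] is what lets an identity on [V] pass to the derivatives. *)
Lemma times_differentiable_eq (F : normedModType R) k (V : set E) (f g : E -> F) :
  open V -> {in V, f =1 g} ->
  times_differentiable k V f -> times_differentiable k V g.
Proof.
move=> oV; elim: k f g => [//|k IH] f g fg [df Df].
have nfg x : V x -> \near x, f x = g x.
  move=> Vx; apply: filterS (open_nbhs_nbhs (conj oV Vx)) => y Vy.
  by apply: fg; rewrite inE.
split=> [x Vx|v]; first exact: near_eq_differentiable (nfg x Vx) (df x Vx).
apply: IH (Df v) => x; rewrite inE => Vx.
by apply: near_eq_derive; exact: nfg.
Qed.

Lemma times_differentiable_sub (F : normedModType R) k (V W : set E) (f : E -> F) :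
  W `<=` V -> times_differentiable k V f -> times_differentiable k W f.
Proof.
move=> WV; elim: k f => [//|k IH] f [df Df].
by split=> [x /WV/df //|v]; apply: IH; exact: Df.
Qed.

Lemma times_differentiableW (F : normedModType R) k (V : set E) (f : E -> F) :
  times_differentiable k.+1 V f -> times_differentiable k V f.
Proof.
by elim: k f => [//|k IH] f [df Df]; split=> // v; apply: IH; exact: Df.
Qed.

Lemma times_differentiable_cst (F : normedModType R) k (V : set E) (a : F) :
  times_differentiable k V (cst a).
Proof.
elim: k a => [//|k IH] a; split=> // v.
suff -> : (fun x => 'D_v (cst a) x) = cst 0 by [].
by apply/funext => x; rewrite derive_cst.
Qed.

Lemma times_differentiableD (F : normedModType R) k (V : set E) (f h : E -> F) :
  open V -> times_differentiable k V f -> times_differentiable k V h ->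
  times_differentiable k V (f + h).
Proof.
move=> oV; elim: k f h => [//|k IH] f h [df Df] [dh Dh].
split=> [x Vx|v]; first exact: differentiableD (df x Vx) (dh x Vx).
apply: times_differentiable_eq (IH _ _ (Df v) (Dh v)) => // x.
by rewrite inE => Vx; rewrite deriveD //; apply/diff_derivable; [exact: df|exact: dh].
Qed.

(** By induction with the Leibniz rule.  The derivative of the product equals
    the Leibniz expression only on [V], hence [times_differentiable_eq]; one of
    the factors stays undifferentiated, hence [times_differentiableW]. *)
Lemma times_differentiableM k (V : set E) (f h : E -> R) :
  open V -> times_differentiable k V f -> times_differentiable k V h ->
  times_differentiable k V (f * h).
Proof.
move=> oV; elim: k f h => [//|k IH] f h tf th.
have [df Df] := tf; have [dh Dh] := th.
split=> [x Vx|v]; first exact: differentiableM (df x Vx) (dh x Vx).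
apply: (@times_differentiable_eq _ _ _
  (f * (fun x => 'D_v h x) + h * (fun x => 'D_v f x))) => //.
  move=> x; rewrite inE => Vx; rewrite deriveM //.
    by apply/diff_derivable/df.
  by apply/diff_derivable/dh.
apply: times_differentiableD => //; apply: IH;
  by [exact: times_differentiableW|exact: Df|exact: Dh].
Qed.

End SmoothMaps.

(** * Smooth functions and tangent vectors *)

Section Manifold.
Variables (R : realType) (M : topologicalType) (m : nat).
Variable A : set (chart R M m).
Hypothesis hM : smooth_manifold A.
Implicit Types (U V W : set M) (f h : M -> R) (p : M).

(** Neighbourhoods of [p] are seen in the chart around [cmap c p] because the
    inverse of the chart map is continuous there. *)
Lemma chart_nbhs c p (P : set M) : A c -> cdom c p -> nbhs p P ->
  \forall x \near cmap c p, P (cinv c x).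
Proof.
move=> Ac cp Pp; have hc := mfd_chart hM Ac.
apply: (chart_inv_cont hc); first by exists p.
by rewrite (chart_mapK hc).
Qed.

Lemma open_chart_image c U : A c -> open U -> open (cmap c @` (U `&` cdom c)).
Proof.
move=> Ac oU; have hc := mfd_chart hM Ac.
rewrite openE => _ [p [Up cp] <-].
have Icp : nbhs (cmap c p) (cmap c @` cdom c).
  by apply: open_nbhs_nbhs; split; [exact: chart_img_open|exists p].
have Ucp := chart_nbhs Ac cp (open_nbhs_nbhs (conj oU Up)).
apply: filterS2 Icp Ucp => _ [q cq <-]; rewrite (chart_mapK hc) // => Uq.
by exists q.
Qed.

Lemma smooth_fun_eq U f h : open U -> (forall p, U p -> f p = h p) ->
  smooth_fun A U f -> smooth_fun A U h.
Proof.
move=> oU fh sf c Ac k; have hc := mfd_chart hM Ac.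
apply: times_differentiable_eq (sf c Ac k); first exact: open_chart_image.
move=> x; rewrite inE => -[p [Up cp] <-] /=.
by rewrite (chart_mapK hc) // fh.
Qed.

Lemma smooth_fun_sub U V f : V `<=` U -> smooth_fun A U f -> smooth_fun A V f.
Proof.
move=> VU sf c Ac k; apply: times_differentiable_sub (sf c Ac k).
by apply: image_subset => p [/VU].
Qed.

Lemma smooth_fun_cst U (a : R) : smooth_fun A U (fun=> a).
Proof. by move=> c Ac k; apply: times_differentiable_cst. Qed.

Lemma smooth_funD U f h : open U -> smooth_fun A U f -> smooth_fun A U h ->
  smooth_fun A U (fun p => f p + h p).
Proof.
move=> oU sf sh c Ac k.
exact: times_differentiableD (open_chart_image Ac oU) (sf c Ac k) (sh c Ac k).
Qed.

Lemma smooth_funM U f h : open U -> smooth_fun A U f -> smooth_fun A U h ->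
  smooth_fun A U (fun p => f p * h p).
Proof.
move=> oU sf sh c Ac k.
exact: times_differentiableM (open_chart_image Ac oU) (sf c Ac k) (sh c Ac k).
Qed.

Lemma smooth_fun_near U p f : open U -> U p -> smooth_fun A U f ->
  smooth_near A p f.
Proof. by move=> oU Up sf; exists U. Qed.

Lemma smooth_near2 p f h : smooth_near A p f -> smooth_near A p h ->
  exists U, [/\ open U, U p, smooth_fun A U f & smooth_fun A U h].
Proof.
move=> [U [oU Up] sf] [V [oV Vp] sh]; exists (U `&` V); split=> //.
- exact: openI.
- exact: smooth_fun_sub sf.
- exact: smooth_fun_sub sh.
Qed.

(** A tangent vector tests smoothness near the base point before it
    differentiates, so its locality requires that this test be local. *)
Lemma smooth_near_eq U p f h : open U -> U p -> (forall q, U q -> f q = h q) ->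
  smooth_near A p f -> smooth_near A p h.
Proof.
move=> oU Up fh [V [oV Vp] sf]; exists (U `&` V).
  by split=> //; exact: openI.
apply: (@smooth_fun_eq _ f); first exact: openI.
- by move=> q [/fh].
- exact: smooth_fun_sub sf.
Qed.

Lemma smooth_near_differentiable p f c : A c -> cdom c p ->
  smooth_near A p f -> differentiable (f \o cinv c) (cmap c p).
Proof.
move=> Ac cp [U [oU Up] sf]; have [df _] := sf c Ac 1%N.
by apply: df; exists p.
Qed.

Lemma dir_derivD c p (a : R) w w' : A c -> cdom c p ->
  dir_deriv A c p (a *: w + w') = a *: dir_deriv A c p w + dir_deriv A c p w'.
Proof.
move=> Ac cp; apply/funext => f; rewrite /dir_deriv !fctE.
case: asboolP => [sf|_]; last by rewrite scaler0 addr0.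
have df := smooth_near_differentiable Ac cp sf.
by rewrite !deriveE // linearP.
Qed.

Lemma dir_deriv0 c p : A c -> cdom c p -> dir_deriv A c p 0 = 0.
Proof.
move=> Ac cp; apply/funext => f; rewrite /dir_deriv.
case: asboolP => // sf.
by rewrite deriveE ?linear0 //; exact: smooth_near_differentiable.
Qed.

Lemma tangentP p (a : R) (u v : vec R M) : tangent A p u -> tangent A p v ->
  tangent A p (a *: u + v).
Proof.
move=> tu tv c Ac cp; have [w ->] := tu c Ac cp; have [w' ->] := tv c Ac cp.
by exists (a *: w + w'); rewrite dir_derivD.
Qed.

Lemma tangent0 p : tangent A p 0.
Proof. by move=> c Ac cp; exists 0; rewrite dir_deriv0. Qed.

Lemma tangentZ p (a : R) (u : vec R M) : tangent A p u -> tangent A p (a *: u).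
Proof. by move=> tu; have := tangentP a tu (@tangent0 p); rewrite addr0. Qed.

Lemma tangentD p (u v : vec R M) : tangent A p u -> tangent A p v ->
  tangent A p (u + v).
Proof. by move=> tu tv; have := tangentP 1 tu tv; rewrite scale1r. Qed.

Lemma tangentN p (u : vec R M) : tangent A p u -> tangent A p (- u).
Proof. by move=> tu; rewrite -scaleN1r; apply: tangentZ. Qed.

Lemma tangentB p (u v : vec R M) : tangent A p u -> tangent A p v ->
  tangent A p (u - v).
Proof. by move=> tu tv; apply: tangentD => //; apply: tangentN. Qed.

(** Tangent vectors are local operators, also on functions at which they are
    set to vanish. *)
Lemma tangent_eq U p (v : vec R M) f h : tangent A p v -> open U -> U p ->
  (forall q, U q -> f q = h q) -> v f = v h.
Proof.
move=> tv oU Up fh; have [c Ac cp] := mfd_cover hM p.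
have [w ->] := tv c Ac cp; rewrite /dir_deriv.
have -> : smooth_near A p f = smooth_near A p h.
  by apply/propext; split; apply: (smooth_near_eq oU) => // q /fh.
case: asboolP => // _; apply: near_eq_derive.
apply: filterS (chart_nbhs Ac cp (open_nbhs_nbhs (conj oU Up))) => x.
exact: fh.
Qed.

Lemma tangent_cst p (v : vec R M) (a : R) : tangent A p v -> v (fun=> a) = 0.
Proof.
move=> tv; have [c Ac cp] := mfd_cover hM p.
have [w ->] := tv c Ac cp; rewrite /dir_deriv.
by case: asboolP => // _; rewrite derive_cst.
Qed.

Lemma tangent_add p (v : vec R M) f h : tangent A p v ->
  smooth_near A p f -> smooth_near A p h ->
  v (fun q => f q + h q) = v f + v h.
Proof.
move=> tv sf sh; have [c Ac cp] := mfd_cover hM p.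
have [w ->] := tv c Ac cp; rewrite /dir_deriv.
have [U [oU Up sUf sUh]] := smooth_near2 sf sh.
have sfh := smooth_fun_near oU Up (smooth_funD oU sUf sUh).
rewrite !asboolT // -deriveD //; apply/diff_derivable;
  exact: smooth_near_differentiable.
Qed.

Lemma tangent_opp p (v : vec R M) f : tangent A p v -> smooth_near A p f ->
  v (fun q => - f q) = - v f.
Proof.
move=> tv sf; apply/eqP; rewrite -addr_eq0; apply/eqP.
have [U [oU Up] sUf] := sf.
rewrite -(tangent_add tv) //.
  rewrite -[RHS](tangent_cst 0 tv); congr (v _).
  by apply/funext => q; rewrite addNr.
exists U => //; apply: (@smooth_fun_eq _ (fun q => (-1) * f q)) => //.
  by move=> q _; rewrite mulN1r.
by apply: smooth_funM => //; exact: smooth_fun_cst.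
Qed.
End Manifold.

(** * Vector fields *)

Section VectorFields.
Variables (R : realType) (M : topologicalType) (m : nat).
Variable A : set (chart R M m).
Hypothesis hM : smooth_manifold A.
Implicit Types (U V W : set M) (f h : M -> R) (p : M).
Implicit Types (u v w : vec R M) (X Y Z : M -> vec R M).

(** Identities between tangent vectors are proved by evaluating both sides at a
    function, which turns them into identities of the ring [R]. *)
Lemma vec_addE u v h : (u + v) h = u h + v h. Proof. by []. Qed.
Lemma vec_oppE u h : (- u) h = - u h. Proof. by []. Qed.
Lemma vec_scaleE (a : R) u h : (a *: u) h = a * u h. Proof. by []. Qed.
Lemma vec_zeroE h : (0 : vec R M) h = 0. Proof. by []. Qed.
Definition vecE := (vec_addE, vec_oppE, vec_scaleE, vec_zeroE).

Lemma vfield_sub U V X : V `<=` U -> vfield A U X -> vfield A V X.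
Proof.
move=> VU [tX sX]; split=> [p /VU/tX //|W f oW WV]; apply: sX => //.
exact: subset_trans VU.
Qed.

Lemma vfield_eq U X Y : open U -> (forall p, U p -> X p = Y p) ->
  vfield A U X -> vfield A U Y.
Proof.
move=> oU XY [tX sX]; split=> [p Up|V f oV VU sf].
  by rewrite -XY //; exact: tX.
apply: (smooth_fun_eq hM (f := fun p => X p f)) => // [p /VU/XY -> //|].
exact: sX.
Qed.

Lemma vfield0 U : vfield A U (fun=> 0).
Proof.
split=> [p Up|V f oV VU sf]; first exact: tangent0.
exact: smooth_fun_cst.
Qed.

Lemma vfield_comb U f X Y : open U -> smooth_fun A U f ->
  vfield A U X -> vfield A U Y -> vfield A U (fun p => f p *: X p + Y p).
Proof.
move=> oU sf [tX sX] [tY sY]; split=> [p Up|V h oV VU sh].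
  exact: tangentP (tX p Up) (tY p Up).
apply: smooth_funD => //; last exact: sY.
by apply: smooth_funM => //; [exact: smooth_fun_sub sf|exact: sX].
Qed.

Lemma vfield_sum (I : Type) (r : seq I) U (f : I -> M -> R)
    (E : I -> M -> vec R M) : open U ->
  (forall i, smooth_fun A U (f i)) -> (forall i, vfield A U (E i)) ->
  vfield A U (fun p => \sum_(i <- r) f i p *: E i p).
Proof.
move=> oU sf vE; elim: r => [|i r IH].
  by apply: vfield_eq oU _ (vfield0 U) => p _; rewrite big_nil.
apply: (vfield_eq oU _ (vfield_comb oU (sf i) (vE i) IH)) => p _.
by rewrite big_cons.
Qed.

End VectorFields.

(** * Connections and tensoriality of the curvature *)

Section Connection.
Variables (R : realType) (M : topologicalType) (m : nat).
Variable A : set (chart R M m).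
Hypothesis hM : smooth_manifold A.
Variable g : M -> vec R M -> vec R M -> R.
Variable nabla : M -> vec R M -> (M -> vec R M) -> vec R M.
Hypothesis hnabla : levi_civita A g nabla.
Implicit Types (U V W : set M) (f h : M -> R) (p : M).
Implicit Types (u v w : vec R M) (X Y Z : M -> vec R M).

Let hconn : connection A nabla := lc_connection hnabla.

Lemma vfield_bracket U X Y : open U -> vfield A U X -> vfield A U Y ->
  vfield A U (bracket A X Y).
Proof.
move=> oU vX vY.
have vXY := conn_smooth hconn oU vX vY; have vYX := conn_smooth hconn oU vY vX.
have sN : smooth_fun A U (fun=> -1) by exact: smooth_fun_cst.
apply: (vfield_eq hM oU _ (vfield_comb hM oU sN vYX vXY)) => p Up.
by rewrite -(lc_torsion_free hnabla oU vX vY Up) scaleN1r addrC.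
Qed.

Lemma nablaZ U p (a : R) v Z : open U -> U p -> tangent A p v ->
  vfield A U Z -> nabla p (a *: v) Z = a *: nabla p v Z.
Proof.
move=> oU Up tv vZ; have t0 : tangent A p 0 by exact: tangent0.
have := conn_linear hconn 1 oU Up t0 t0 vZ.
rewrite scaler0 addr0 scale1r -[LHS]addr0 => /addrI nabla00.
by have := conn_linear hconn a oU Up tv t0 vZ; rewrite -nabla00 !addr0.
Qed.

(** Additivity and the Leibniz rule of a connection in the single form in which
    tensoriality is checked, with [f *: Y + Z] as the test field. *)
Lemma nabla_comb U p v f Y Z : open U -> U p -> tangent A p v ->
  smooth_fun A U f -> vfield A U Y -> vfield A U Z ->
  nabla p v (fun q => f q *: Y q + Z q)
  = v f *: Y p + f p *: nabla p v Y + nabla p v Z.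
Proof.
move=> oU Up tv sf vY vZ.
have vfY : vfield A U (fun q => f q *: Y q).
  apply: (vfield_eq hM oU _ (vfield_comb hM oU sf vY (vfield0 A U))) => q _.
  by rewrite addr0.
by rewrite (conn_add hconn oU Up tv vfY vZ) (conn_leibniz hconn oU Up tv sf vY).
Qed.

(** Freedom from torsion expresses the bracket by the connection, so that the
    Leibniz rule of the connection gives that of the bracket. *)
Lemma bracket_comb U p f X X' Y : open U -> U p -> smooth_fun A U f ->
  vfield A U X -> vfield A U X' -> vfield A U Y ->
  bracket A (fun q => f q *: X q + X' q) Y p
  = f p *: bracket A X Y p + (- Y p f *: X p + bracket A X' Y p).
Proof.
move=> oU Up sf vX vX' vY.
have vfX := vfield_comb hM oU sf vX vX'.
rewrite -!(lc_torsion_free hnabla oU _ _ Up) // /cov.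
rewrite (conn_linear hconn _ oU Up (vX.1 p Up) (vX'.1 p Up) vY).
rewrite (nabla_comb oU Up (vY.1 p Up) sf vX vX').
by apply/funext => h; rewrite !vecE; ring.
Qed.

(** The curvature at a point only depends on the germs of the three fields. *)
Lemma curvature_eq U p X X' Y Y' Z Z' : open U -> U p ->
  vfield A U X -> vfield A U X' -> vfield A U Y -> vfield A U Y' ->
  vfield A U Z -> vfield A U Z' ->
  (forall q, U q -> X q = X' q) -> (forall q, U q -> Y q = Y' q) ->
  (forall q, U q -> Z q = Z' q) ->
  curvature A nabla X Y Z p = curvature A nabla X' Y' Z' p.
Proof.
move=> oU Up vX vX' vY vY' vZ vZ' eX eY eZ; rewrite /curvature.
have covE S S' T T' q : U q -> vfield A U S -> vfield A U T -> vfield A U T' ->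
    (forall q, U q -> S q = S' q) -> (forall q, U q -> T q = T' q) ->
    cov nabla S T q = cov nabla S' T' q.
  move=> Uq vS vT vT' eS eT; rewrite /cov -eS //.
  exact: (conn_local hconn oU Uq (vS.1 q Uq) vT vT' eT).
have vc S T : vfield A U S -> vfield A U T -> vfield A U (cov nabla S T).
  exact: conn_smooth.
have vb S T : vfield A U S -> vfield A U T -> vfield A U (bracket A S T).
  exact: vfield_bracket.
have ccE S T T' : vfield A U S -> vfield A U T -> vfield A U T' ->
    (forall q, U q -> T q = T' q) ->
    forall S', vfield A U S' -> (forall q, U q -> S q = S' q) ->
    cov nabla S (cov nabla T Z) p = cov nabla S' (cov nabla T' Z') p.
  move=> vS vT vT' eT S' vS' eS.
  apply: (covE) => //; [exact: vc|exact: vc|].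
  by move=> q Uq; exact: covE.
congr (_ - _ - _); [exact: ccE|exact: ccE|apply: (covE) => //; first exact: vb].
by move=> q Uq; rewrite -!(lc_torsion_free hnabla oU _ _ Uq) //; congr (_ - _);
  exact: covE.
Qed.

Lemma curvatureC U p X Y Z : open U -> U p ->
  vfield A U X -> vfield A U Y -> vfield A U Z ->
  curvature A nabla X Y Z p = - curvature A nabla Y X Z p.
Proof.
move=> oU Up vX vY vZ; rewrite /curvature /cov.
have tb : tangent A p (bracket A Y X p) := (vfield_bracket oU vY vX).1 p Up.
have -> : bracket A X Y p = -1 *: bracket A Y X p.
  by rewrite -!(lc_torsion_free hnabla oU _ _ Up) // scaleN1r opprB.
rewrite (nablaZ _ oU Up tb vZ).
by apply/funext => h; rewrite !vecE; ring.
Qed.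

(** The term in which [Y] differentiates [f] arises once from
    [nabla_Y nabla_(f X) Z] and once, with the opposite sign, from the
    direction [bracket (f X) Y]. *)
Lemma curvature_comb1 U p f X X' Y Z : open U -> U p -> smooth_fun A U f ->
  vfield A U X -> vfield A U X' -> vfield A U Y -> vfield A U Z ->
  curvature A nabla (fun q => f q *: X q + X' q) Y Z p
  = f p *: curvature A nabla X Y Z p + curvature A nabla X' Y Z p.
Proof.
move=> oU Up sf vX vX' vY vZ.
have vfX := vfield_comb hM oU sf vX vX'.
have vc S T : vfield A U S -> vfield A U T -> vfield A U (cov nabla S T).
  exact: conn_smooth.
have tb S T : vfield A U S -> vfield A U T -> tangent A p (bracket A S T p).
  by move=> vS vT; exact: (vfield_bracket oU vS vT).1.
rewrite /curvature.
have -> : cov nabla (fun q => f q *: X q + X' q) (cov nabla Y Z) p =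
    f p *: cov nabla X (cov nabla Y Z) p + cov nabla X' (cov nabla Y Z) p.
  exact: (conn_linear hconn _ oU Up (vX.1 p Up) (vX'.1 p Up) (vc _ _ vY vZ)).
have -> : cov nabla Y (cov nabla (fun q => f q *: X q + X' q) Z) p =
    nabla p (Y p) (fun q => f q *: cov nabla X Z q + cov nabla X' Z q).
  apply: (conn_local hconn oU Up (vY.1 p Up)); first exact: vc.
    by apply: vfield_comb => //; exact: vc.
  by move=> q Uq; rewrite /cov (conn_linear hconn _ oU Uq (vX.1 q Uq) (vX'.1 q Uq)).
rewrite (nabla_comb oU Up (vY.1 p Up) sf (vc _ _ vX vZ) (vc _ _ vX' vZ)).
rewrite [cov nabla (bracket _ (fun _ => _) _) _ _]/cov (bracket_comb oU Up sf vX vX' vY).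
have tX := vX.1 p Up.
rewrite (conn_linear hconn _ oU Up (tb _ _ vX vY) (tangentP _ tX (tb _ _ vX' vY)) vZ).
rewrite (conn_linear hconn _ oU Up tX (tb _ _ vX' vY) vZ).
by apply/funext => h; rewrite !vecE /cov; ring.
Qed.

Lemma curvature_comb2 U p f X Y Y' Z : open U -> U p -> smooth_fun A U f ->
  vfield A U X -> vfield A U Y -> vfield A U Y' -> vfield A U Z ->
  curvature A nabla X (fun q => f q *: Y q + Y' q) Z p
  = f p *: curvature A nabla X Y Z p + curvature A nabla X Y' Z p.
Proof.
move=> oU Up sf vX vY vY' vZ.
have vfY := vfield_comb hM oU sf vY vY'.
rewrite !(curvatureC oU Up vX) // (curvature_comb1 oU) //.
by apply/funext => h; rewrite !vecE; ring.
Qed.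

(** The terms with first derivatives of [f] are symmetric in [X] and [Y] and
    cancel; the second derivatives leave [X (Y f) - Y (X f)], which is what the
    direction [bracket X Y] contributes. *)
Lemma curvature_comb3 U p f X Y Z Z' : open U -> U p -> smooth_fun A U f ->
  vfield A U X -> vfield A U Y -> vfield A U Z -> vfield A U Z' ->
  curvature A nabla X Y (fun q => f q *: Z q + Z' q) p
  = f p *: curvature A nabla X Y Z p + curvature A nabla X Y Z' p.
Proof.
move=> oU Up sf vX vY vZ vZ'.
have vfZ := vfield_comb hM oU sf vZ vZ'.
have vc S T : vfield A U S -> vfield A U T -> vfield A U (cov nabla S T).
  exact: conn_smooth.
have cc S T : vfield A U S -> vfield A U T ->
    cov nabla S (cov nabla T (fun q => f q *: Z q + Z' q)) p =
    S p (fun q => T q f) *: Z p + T p f *: cov nabla S Z p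
    + (S p f *: cov nabla T Z p + f p *: cov nabla S (cov nabla T Z) p
       + cov nabla S (cov nabla T Z') p).
  move=> vS vT.
  have sTf : smooth_fun A U (fun q => T q f) by exact: vT.2.
  have v2 : vfield A U (fun q => f q *: cov nabla T Z q + cov nabla T Z' q).
    by apply: vfield_comb => //; exact: vc.
  rewrite /cov -(nabla_comb oU Up (vS.1 p Up) sf (vc _ _ vT vZ) (vc _ _ vT vZ')).
  rewrite -(nabla_comb oU Up (vS.1 p Up) sTf vZ v2).
  apply: (conn_local hconn oU Up (vS.1 p Up)); first exact: vc.
    exact: vfield_comb.
  move=> q Uq; rewrite (nabla_comb oU Uq (vT.1 q Uq) sf vZ vZ').
  by rewrite addrA.
have bf : bracket A X Y p f = X p (fun q => Y q f) - Y p (fun q => X q f).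
  by rewrite /bracket asboolT //; exists U.
rewrite /curvature !cc // [cov nabla (bracket _ _ _) (fun _ => _) _]/cov.
rewrite (nabla_comb oU Up ((vfield_bracket oU vX vY).1 p Up) sf vZ vZ') bf.
by apply/funext => h; rewrite !vecE /cov; ring.
Qed.
End Connection.

(** * Metric linear algebra of a tangent space *)

Section Metric.
Variables (R : realType) (M : topologicalType) (m : nat).
Variable A : set (chart R M m).
Variable g : M -> vec R M -> vec R M -> R.
Hypothesis hg : riemannian_metric A g.
Implicit Types (u v w : vec R M) (p : M).

Lemma tangent_sum p (I : Type) (r : seq I) (c : I -> R) (B : I -> vec R M) :
  (forall i, tangent A p (B i)) -> tangent A p (\sum_(i <- r) c i *: B i).
Proof.
move=> tB; elim: r => [|i r IH]; first by rewrite big_nil; exact: tangent0.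
by rewrite big_cons; exact: tangentP.
Qed.

Lemma covector0 p (b : vec R M -> R) : covector A p b -> b 0 = 0.
Proof.
move=> cb; have := cb 1 0 0 (@tangent0 _ _ _ A p) (@tangent0 _ _ _ A p).
by rewrite scaler0 addr0 mul1r => /eqP; rewrite -subr_eq subrr => /eqP <-.
Qed.

Lemma covector_sum p (b : vec R M -> R) (I : Type) (r : seq I) (c : I -> R)
    (B : I -> vec R M) : covector A p b -> (forall i, tangent A p (B i)) ->
  b (\sum_(i <- r) c i *: B i) = \sum_(i <- r) c i * b (B i).
Proof.
move=> cb tB; elim: r => [|i r IH]; first by rewrite !big_nil (covector0 cb).
by rewrite !big_cons cb // ?IH //; exact: tangent_sum.
Qed.

Lemma metric_linearl p u : tangent A p u -> covector A p (g p ^~ u).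
Proof.
move=> tu a v w tv tw; have tavw := tangentP a tv tw.
rewrite (Defs.metric_sym hg tavw tu) (metric_linear hg tu) //.
by rewrite (Defs.metric_sym hg tu tv) (Defs.metric_sym hg tu tw).
Qed.

Lemma metricNl p u v : tangent A p u -> tangent A p v -> g p (- u) v = - g p u v.
Proof.
move=> tu tv; have := metric_linearl tv (-1) tu (@tangent0 _ _ _ A p).
by rewrite (covector0 (metric_linearl tv)) addr0 scaleN1r addr0 mulN1r.
Qed.

Lemma metricNr p u v : tangent A p u -> tangent A p v -> g p u (- v) = - g p u v.
Proof.
move=> tu tv; rewrite (Defs.metric_sym hg tu (tangentN tv)) metricNl //.
by rewrite (Defs.metric_sym hg tu tv).
Qed.

Lemma metricDl p u v w : tangent A p u -> tangent A p v -> tangent A p w ->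
  g p (u + v) w = g p u w + g p v w.
Proof.
by move=> tu tv tw; have := metric_linearl tw 1 tu tv; rewrite scale1r mul1r.
Qed.

Lemma metricBl p u v w : tangent A p u -> tangent A p v -> tangent A p w ->
  g p (u - v) w = g p u w - g p v w.
Proof.
by move=> tu tv tw; rewrite metricDl ?metricNl //; exact: tangentN.
Qed.

Lemma metricZl p (a : R) u v : tangent A p u -> tangent A p v ->
  g p (a *: u) v = a * g p u v.
Proof.
move=> tu tv; have := metric_linearl tv a tu (@tangent0 _ _ _ A p).
by rewrite (covector0 (metric_linearl tv)) !addr0.
Qed.

Lemma dir_deriv_sum c p (I : Type) (r : seq I) (a : I -> R)
    (w : I -> 'rV[R]_m) : A c -> cdom c p ->
  dir_deriv A c p (\sum_(i <- r) a i *: w i)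
  = \sum_(i <- r) a i *: dir_deriv A c p (w i).
Proof.
move=> Ac cp; elim: r => [|i r IH]; first by rewrite !big_nil dir_deriv0.
by rewrite !big_cons dir_derivD // IH.
Qed.

Lemma orthonormal_coord p (B : 'I_m -> vec R M) (c : 'I_m -> R) j :
  orthonormal_basis A g p B -> g p (\sum_i c i *: B i) (B j) = c j.
Proof.
move=> [tB oB]; rewrite (covector_sum _ _ (metric_linearl (tB j)) tB).
rewrite (bigD1 j) //= oB eqxx mulr1 big1 ?addr0 // => i /negPf ij.
by rewrite oB ij mulr0.
Qed.

Hypothesis hM : smooth_manifold A.

(** In a chart the tangent vectors at [p] are the images of the vectors of
    R^m, and the representatives of an orthonormal m-tuple are linearly
    independent, hence a basis of R^m. *)
Lemma orthonormal_expansion p (B : 'I_m -> vec R M) u :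
  orthonormal_basis A g p B -> tangent A p u ->
  u = \sum_i g p u (B i) *: B i.
Proof.
move=> oB tu; have [tB _] := oB; have [c Ac cp] := mfd_cover hM p.
have /choice[w wE] := fun i => tB i c Ac cp.
have [x ux] := tu c Ac cp.
have BE (y : 'rV[R]_m) : dir_deriv A c p (y *m \matrix_i w i) = \sum_i y 0 i *: B i.
  rewrite mulmx_sum_row dir_deriv_sum //.
  by apply: eq_bigr => i _; rewrite rowK wE.
have Wfree : row_free (\matrix_i w i).
  apply: inj_row_free => y yW0; apply/rowP => j.
  rewrite -(orthonormal_coord (fun i => y 0 i) j oB) -BE yW0 dir_deriv0 // mxE.
  exact: covector0 (metric_linearl (tB j)).
have uE : u = \sum_i (x *m invmx (\matrix_i w i)) 0 i *: B i.
  by rewrite -BE mulmxKV // -row_free_unit.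
rewrite [LHS]uE; apply: eq_bigr => j _; congr (_ *: _).
by rewrite [in RHS]uE orthonormal_coord.
Qed.

(** Expanding one basis in the other introduces the transition matrix Q in the
    combination Q^T Q = 1. *)
Lemma trace_orthonormal p (B B' : 'I_m -> vec R M) (b : vec R M -> vec R M -> R) :
  orthonormal_basis A g p B -> orthonormal_basis A g p B' ->
  (forall u, tangent A p u -> covector A p (b u)) ->
  (forall u, tangent A p u -> covector A p (b ^~ u)) ->
  \sum_i b (B i) (B i) = \sum_i b (B' i) (B' i).
Proof.
move=> oB oB' br bl; have [tB _] := oB; have [tB' oB'E] := oB'.
under eq_bigr => i _.
  rewrite (orthonormal_expansion oB' (tB i)).
  rewrite (covector_sum _ _ (bl _ (tangent_sum _ _ tB')) tB').
  under eq_bigr => j _ do rewrite (covector_sum _ _ (br _ (tB' j)) tB').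
  over.
rewrite exchange_big /=; apply: eq_bigr => j _.
have QQ k : \sum_i g p (B i) (B' j) * g p (B i) (B' k) = (k == j)%:R.
  rewrite -oB'E [in RHS](orthonormal_expansion oB (tB' k)).
  rewrite (covector_sum _ _ (metric_linearl (tB' j)) tB).
  apply: eq_bigr => i _; rewrite mulrC; congr (_ * _).
  exact: (Defs.metric_sym hg (tB i) (tB' k)).
under eq_bigr => i _ do rewrite mulr_sumr.
rewrite exchange_big (bigD1 j) //= [X in _ + X]big1 ?addr0 => [|k /negPf kj].
  under eq_bigr => i _ do rewrite mulrA.
  by rewrite -mulr_suml QQ eqxx mul1r.
under eq_bigr => i _ do rewrite mulrA.
by rewrite -mulr_suml QQ kj mul0r.
Qed.
End Metric.

(** * Curvature in an orthonormal frame *)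

Section Frame.
Variables (R : realType) (M : topologicalType) (m : nat).
Variable A : set (chart R M m).
Hypothesis hM : smooth_manifold A.
Variable g : M -> vec R M -> vec R M -> R.
Hypothesis hg : riemannian_metric A g.
Variable nabla : M -> vec R M -> (M -> vec R M) -> vec R M.
Hypothesis hnabla : levi_civita A g nabla.
Variables (U : set M) (E : 'I_m -> M -> vec R M).
Hypothesis oU : open U.
Hypothesis vE : forall i, vfield A U (E i).
Hypothesis oE : forall p, U p -> orthonormal_basis A g p (E ^~ p).
Implicit Types (u v w : vec R M) (p : M) (X Y Z : M -> vec R M).

Let hconn : connection A nabla := lc_connection hnabla.

(** Combinations of the frame with constant coefficients. *)
Lemma frame_extension p v : U p -> tangent A p v ->
  exists2 X, vfield A U X & X p = v.
Proof.
move=> Up tv; exists (fun q => \sum_i g p v (E i p) *: E i q).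
  apply: (vfield_sum hM _ (f := fun i _ => g p v (E i p))) => // i.
  exact: smooth_fun_cst.
by rewrite [RHS](orthonormal_expansion hg hM (oE Up) tv).
Qed.

Lemma extensionP p v : U p -> tangent A p v ->
  extension A p v p = v /\
  exists2 V, open_nbhs p V & vfield A V (extension A p v).
Proof.
move=> Up tv.
have [X vX Xp] := frame_extension Up tv.
apply: (xgetPex 0 (P := [set X : M -> vec R M |
  X p = v /\ exists2 V, open_nbhs p V & vfield A V X])).
by exists X; split=> //; exists U.
Qed.

(** Locality allows [X] to be replaced by its expansion in the frame, and
    function-linearity then evaluates the smooth coefficients at [p]. *)
Lemma tensorial_frame W p (F : (M -> vec R M) -> vec R M) : open W -> W p ->
  W `<=` U ->
  (forall f X Y, smooth_fun A W f -> vfield A W X -> vfield A W Y ->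
     F (fun q => f q *: X q + Y q) = f p *: F X + F Y) ->
  (forall X Y, vfield A W X -> vfield A W Y -> (forall q, W q -> X q = Y q) ->
     F X = F Y) ->
  forall X, vfield A W X -> F X = \sum_i g p (X p) (E i p) *: F (E i).
Proof.
move=> oW Wp WU Fcomb Feq X vX.
have vEW i : vfield A W (E i) by exact: vfield_sub (vE i).
have sf i : smooth_fun A W (fun q => g q (X q) (E i q)).
  exact: (metric_smooth hg).
have Fsum (r : seq 'I_m) :
    F (fun q => \sum_(i <- r) g q (X q) (E i q) *: E i q)
    = \sum_(i <- r) g p (X p) (E i p) *: F (E i).
  elim: r => [|i r IH].
    (* F 0 = 0, since 0 = 1 * 0 + 0 as fields. *)
    have F00 := Fcomb (fun=> 1) (fun=> 0) (fun=> 0)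
      (smooth_fun_cst _ _) (vfield0 _ _) (vfield0 _ _).
    rewrite big_nil; apply: (@addrI _ (F (fun=> 0))).
    rewrite addr0 -[X in X + _ = _]scale1r.
    have -> : (fun q => \sum_(i <- [::]) g q (X q) (E i q) *: E i q)
        = (fun=> 0) by apply/funext => q; rewrite big_nil.
    rewrite -F00; congr F; apply/funext => q; by rewrite scaler0 addr0.
  have vr := vfield_sum hM r oW sf vEW.
  rewrite big_cons -IH -(Fcomb _ _ _ (sf i) (vEW i) vr); congr F.
  by apply/funext => q; rewrite big_cons.
rewrite -Fsum; apply: Feq => //; first exact: (vfield_sum hM _).
move=> q Wq; apply: (orthonormal_expansion hg hM (oE (WU q Wq))).
exact: vX.1.
Qed.

(** The right-hand side involves [X], [Y] and [Z] only through their values at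
    [p]: this is the pointwise nature of the curvature. *)
Lemma curvature_frame W p X Y Z : open W -> W p -> W `<=` U ->
  vfield A W X -> vfield A W Y -> vfield A W Z ->
  curvature A nabla X Y Z p =
  \sum_i g p (X p) (E i p) *: \sum_j g p (Y p) (E j p) *:
    \sum_k g p (Z p) (E k p) *: curvature A nabla (E i) (E j) (E k) p.
Proof.
move=> oW Wp WU vX vY vZ.
have vEW i : vfield A W (E i) by exact: vfield_sub (vE i).
rewrite (tensorial_frame (F := fun X => curvature A nabla X Y Z p) oW Wp WU) //.
- apply: eq_bigr => i _; congr (_ *: _).
  rewrite (tensorial_frame (F := fun Y => curvature A nabla (E i) Y Z p) oW Wp WU) //.
  + apply: eq_bigr => j _; congr (_ *: _).
    apply: (tensorial_frame (F := fun Z => curvature A nabla (E i) (E j) Z p)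
      oW Wp WU) => //.
    * by move=> *; apply: (curvature_comb3 hM hnabla oW).
    * by move=> *; apply: (curvature_eq hM hnabla oW).
  + by move=> *; apply: (curvature_comb2 hM hnabla oW).
  + by move=> *; apply: (curvature_eq hM hnabla oW).
- by move=> *; apply: (curvature_comb1 hM hnabla oW).
- by move=> *; apply: (curvature_eq hM hnabla oW).
Qed.

(** The chosen extensions live on smaller neighbourhoods than the frame, so the
    comparison takes place on the intersection. *)
Lemma riemannE p X Y Z : U p -> vfield A U X -> vfield A U Y -> vfield A U Z ->
  riemann A nabla p (X p) (Y p) (Z p) = curvature A nabla X Y Z p.
Proof.
move=> Up vX vY vZ; rewrite /riemann.
have [Xp [V1 [oV1 V1p] vX']] := extensionP Up (vX.1 p Up).
have [Yp [V2 [oV2 V2p] vY']] := extensionP Up (vY.1 p Up).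
have [Zp [V3 [oV3 V3p] vZ']] := extensionP Up (vZ.1 p Up).
pose W := U `&` (V1 `&` (V2 `&` V3)).
have oW : open W by do 3 apply: openI => //.
have Wp : W p by [].
have WU : W `<=` U by move=> q [].
have W1 : W `<=` V1 by move=> q [_ []].
have W2 : W `<=` V2 by move=> q [_ [_ []]].
have W3 : W `<=` V3 by move=> q [_ [_ []]].
rewrite (curvature_frame oW Wp WU (vfield_sub W1 vX') (vfield_sub W2 vY')
  (vfield_sub W3 vZ')).
by rewrite Xp Yp Zp (curvature_frame oU Up (@subset_refl _ U) vX vY vZ).
Qed.

Lemma curvature_tangent p X Y Z : U p ->
  vfield A U X -> vfield A U Y -> vfield A U Z ->
  tangent A p (curvature A nabla X Y Z p).
Proof.
move=> Up vX vY vZ; have vc := conn_smooth hconn oU.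
have vb := vfield_bracket hM hnabla oU.
apply: tangentB; first apply: tangentB.
- exact: (vc _ _ vX (vc _ _ vY vZ)).1.
- exact: (vc _ _ vY (vc _ _ vX vZ)).1.
- exact: (vc _ _ (vb _ _ vX vY) vZ).1.
Qed.

Lemma riemann_tangent p u v w : U p ->
  tangent A p u -> tangent A p v -> tangent A p w ->
  tangent A p (riemann A nabla p u v w).
Proof.
move=> Up /(frame_extension Up)[X vX <-] /(frame_extension Up)[Y vY <-].
move=> /(frame_extension Up)[Z vZ <-].
by rewrite riemannE //; exact: curvature_tangent.
Qed.

Lemma riemann_linear1 p (a : R) u u' v w : U p ->
  tangent A p u -> tangent A p u' -> tangent A p v -> tangent A p w ->
  riemann A nabla p (a *: u + u') v w
  = a *: riemann A nabla p u v w + riemann A nabla p u' v w.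
Proof.
move=> Up /(frame_extension Up)[X vX <-] /(frame_extension Up)[X' vX' <-].
move=> /(frame_extension Up)[Y vY <-] /(frame_extension Up)[Z vZ <-].
have sa : smooth_fun A U (fun=> a) by exact: smooth_fun_cst.
rewrite (@riemannE p (fun q => a *: X q + X' q)) ?riemannE //; last first.
  exact: (vfield_comb hM oU sa).
exact: (curvature_comb1 hM hnabla oU Up sa).
Qed.

Lemma riemann_linear2 p (a : R) u v v' w : U p ->
  tangent A p u -> tangent A p v -> tangent A p v' -> tangent A p w ->
  riemann A nabla p u (a *: v + v') w
  = a *: riemann A nabla p u v w + riemann A nabla p u v' w.
Proof.
move=> Up /(frame_extension Up)[X vX <-] /(frame_extension Up)[Y vY <-].
move=> /(frame_extension Up)[Y' vY' <-] /(frame_extension Up)[Z vZ <-].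
have sa : smooth_fun A U (fun=> a) by exact: smooth_fun_cst.
rewrite (@riemannE p X (fun q => a *: Y q + Y' q)) ?riemannE //; last first.
  exact: (vfield_comb hM oU sa).
exact: (curvature_comb2 hM hnabla oU Up sa).
Qed.

Lemma riemann_linear3 p (a : R) u v w w' : U p ->
  tangent A p u -> tangent A p v -> tangent A p w -> tangent A p w' ->
  riemann A nabla p u v (a *: w + w')
  = a *: riemann A nabla p u v w + riemann A nabla p u v w'.
Proof.
move=> Up /(frame_extension Up)[X vX <-] /(frame_extension Up)[Y vY <-].
move=> /(frame_extension Up)[Z vZ <-] /(frame_extension Up)[Z' vZ' <-].
have sa : smooth_fun A U (fun=> a) by exact: smooth_fun_cst.
rewrite (@riemannE p X Y (fun q => a *: Z q + Z' q)) ?riemannE //; last first.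
  exact: (vfield_comb hM oU sa).
exact: (curvature_comb3 hM hnabla oU Up sa).
Qed.

Lemma onbP p : U p -> orthonormal_basis A g p (onb A g p).
Proof. by move=> Up; apply: xgetPex; exists (E ^~ p); exact: oE. Qed.

(** Ricci curvature is a trace, so the arbitrary orthonormal basis of its
    definition may be replaced by the frame. *)
Lemma ricci_frame p u v : U p -> tangent A p u -> tangent A p v ->
  ricci A g nabla p u v = \sum_i g p (riemann A nabla p (E i p) u v) (E i p).
Proof.
move=> Up tu tv.
apply: (trace_orthonormal hg hM (b := fun x y => g p (riemann A nabla p x u v) y)
  (onbP Up) (oE Up)) => x tx.
- by apply: (metric_linear hg); exact: riemann_tangent.
- move=> a y z ty tz; rewrite riemann_linear1 //.
  by apply: (metric_linearl hg tx); exact: riemann_tangent.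
Qed.

Lemma scalar_curvature_frame p : U p ->
  scalar_curvature A g nabla p = \sum_i ricci A g nabla p (E i p) (E i p).
Proof.
move=> Up; have [tB _] := onbP Up.
apply: (trace_orthonormal hg hM (onbP Up) (oE Up)) => u tu a v w tv tw;
  rewrite /ricci mulr_sumr -big_split; apply: eq_bigr => i _ /=.
- rewrite riemann_linear3 //.
  by apply: (metric_linearl hg (tB i)); exact: riemann_tangent.
- rewrite riemann_linear2 //.
  by apply: (metric_linearl hg (tB i)); exact: riemann_tangent.
Qed.

(** Compatibility with the metric moves the outer derivatives out of the inner
    product and leaves an expression in the coefficients g (nabla_X Y) Z, their
    derivatives and products of first covariant derivatives. *)
Lemma curvature_metric p X Y Z W : U p ->
  vfield A U X -> vfield A U Y -> vfield A U Z -> vfield A U W ->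
  g p (curvature A nabla X Y Z p) (W p) =
    X p (fun q => g q (cov nabla Y Z q) (W q))
    - Y p (fun q => g q (cov nabla X Z q) (W q))
    - g p (cov nabla Y Z p) (cov nabla X W p)
    + g p (cov nabla X Z p) (cov nabla Y W p)
    - g p (cov nabla (bracket A X Y) Z p) (W p).
Proof.
move=> Up vX vY vZ vW; have vc := conn_smooth hconn oU.
have vb := vfield_bracket hM hnabla oU.
have tc S T (vS : vfield A U S) (vT : vfield A U T) := (vc S T vS vT).1 p Up.
rewrite (lc_metric hnabla oU vX (vc _ _ vY vZ) vW Up).
rewrite (lc_metric hnabla oU vY (vc _ _ vX vZ) vW Up).
have tW := vW.1 p Up.
have t1 := tc _ _ vX (vc _ _ vY vZ); have t2 := tc _ _ vY (vc _ _ vX vZ).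
have t3 := tc _ _ (vb _ _ vX vY) vZ.
rewrite /curvature !(metricBl hg) //; first by ring.
exact: tangentB.
Qed.

(** Differentiate the constant [g Y Z]. *)
Lemma cov_skew (c : R) p X Y Z : U p ->
  vfield A U X -> vfield A U Y -> vfield A U Z ->
  (forall q, U q -> g q (Y q) (Z q) = c) ->
  g p (cov nabla X Y p) (Z p) = - g p (cov nabla X Z p) (Y p).
Proof.
move=> Up vX vY vZ YZ; have tX := vX.1 p Up.
apply/eqP; rewrite -addr_eq0; apply/eqP.
rewrite -[RHS](tangent_cst hM c tX) -(tangent_eq hM tX oU Up YZ).
rewrite (lc_metric hnabla oU vX vY vZ Up); congr (_ + _).
by apply: (Defs.metric_sym hg); [exact: (conn_smooth hconn oU vX vZ).1|exact: vY.1].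
Qed.

(** Skew-symmetry in the last two slots.  For a pair with constant inner product
    each of the connection coefficients in [curvature_metric] is skew, and the
    two products of covariant derivatives are exchanged. *)
Lemma curvature_skew (c : R) p X Y Z W : U p ->
  vfield A U X -> vfield A U Y -> vfield A U Z -> vfield A U W ->
  (forall q, U q -> g q (Z q) (W q) = c) ->
  g p (curvature A nabla X Y Z p) (W p)
  = - g p (curvature A nabla X Y W p) (Z p).
Proof.
move=> Up vX vY vZ vW ZW; have vc := conn_smooth hconn oU.
have tc S T (vS : vfield A U S) (vT : vfield A U T) := (vc S T vS vT).1 p Up.
rewrite !curvature_metric //.
have dskew S T : vfield A U S -> vfield A U T ->
    S p (fun q => g q (cov nabla T Z q) (W q))
    = - S p (fun q => g q (cov nabla T W q) (Z q)).
  move=> vS vT; have tS := vS.1 p Up.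
  have sTW : smooth_near A p (fun q => g q (cov nabla T W q) (Z q)).
    by exists U => //; apply: (metric_smooth hg) => //; exact: vc.
  rewrite -(tangent_opp hM tS sTW); apply: (tangent_eq hM tS oU Up) => q Uq.
  exact: cov_skew ZW.
rewrite !dskew // (cov_skew Up (vfield_bracket hM hnabla oU vX vY) vZ vW ZW).
rewrite (Defs.metric_sym hg (tc _ _ vY vZ) (tc _ _ vX vW)).
rewrite (Defs.metric_sym hg (tc _ _ vX vZ) (tc _ _ vY vW)).
by ring.
Qed.

End Frame.

(** * Ricci curvature in dimension 3 *)

Section Dimension3.
Variables (R : realType) (M : topologicalType).
Variable A : set (chart R M 3).
Hypothesis hM : smooth_manifold A.
Variable g : M -> vec R M -> vec R M -> R.
Hypothesis hg : riemannian_metric A g.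
Variable nabla : M -> vec R M -> (M -> vec R M) -> vec R M.
Hypothesis hnabla : levi_civita A g nabla.
Variables (U : set M) (X1 X2 X3 : M -> vec R M).
Hypothesis oU : open U.
Hypotheses (v1 : vfield A U X1) (v2 : vfield A U X2) (v3 : vfield A U X3).
Hypothesis o123 : forall q, U q ->
  [/\ g q (X1 q) (X1 q) = 1, g q (X2 q) (X2 q) = 1, g q (X3 q) (X3 q) = 1 &
   [/\ g q (X1 q) (X2 q) = 0, g q (X1 q) (X3 q) = 0 & g q (X2 q) (X3 q) = 0]].

Let E (i : 'I_3) q : vec R M := nth 0 [:: X1 q; X2 q; X3 q] i.

Let vE i : vfield A U (E i).
Proof. by case: i => -[|[|[|]]]. Qed.

Let oE q : U q -> orthonormal_basis A g q (E ^~ q).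
Proof.
move=> Uq; split=> [i|]; first exact: (vE i).1.
have [ o11 o22 o33 [ o12 o13 o23]] := o123 Uq.
have t1 := v1.1 q Uq; have t2 := v2.1 q Uq; have t3 := v3.1 q Uq.
have o21 := Defs.metric_sym hg t2 t1; have o31 := Defs.metric_sym hg t3 t1.
have o32 := Defs.metric_sym hg t3 t2.
by move=> [[|[|[|//]]] ilt] [[|[|[|//]]] jlt]; rewrite /E /= ?o21 ?o31 ?o32.
Qed.

Lemma sum_ord3 (V : nmodType) (F : 'I_3 -> V) :
  \sum_i F i = F 0 + F 1 + F (1 + 1).
Proof.
rewrite !big_ord_recl big_ord0 addr0 addrA.
by congr (F _ + F _ + F _); apply: val_inj.
Qed.

Lemma frame3_expansion q u : U q -> tangent A q u ->
  u = g q u (X1 q) *: X1 q + g q u (X2 q) *: X2 q + g q u (X3 q) *: X3 q.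
Proof.
by move=> Uq tu; rewrite {1}(orthonormal_expansion hg hM (oE Uq) tu) sum_ord3.
Qed.

Lemma parseval3 q u v : U q -> tangent A q u -> tangent A q v ->
  g q u v = g q u (X1 q) * g q v (X1 q) + g q u (X2 q) * g q v (X2 q)
            + g q u (X3 q) * g q v (X3 q).
Proof.
move=> Uq tu tv; have tE i : tangent A q (E i q) by exact: (vE i).1.
rewrite {1}(orthonormal_expansion hg hM (oE Uq) tu).
rewrite (covector_sum _ _ (metric_linearl hg tv) tE) sum_ord3.
by rewrite !(fun i => Defs.metric_sym hg (tE i) tv).
Qed.

(** With Kij the sectional curvatures of the coordinate planes, the left-hand
    side is 2 (K13 + K23) - 2 (K12 + K13 + K23). *)
Lemma ricci_sub_scalar p : U p ->
  2 * ricci A g nabla p (X3 p) (X3 p) - scalar_curvature A g nabla p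
  = - (2 * g p (curvature A nabla X1 X2 X2 p) (X1 p)).
Proof.
move=> Up; pose K X Y := g p (curvature A nabla X Y Y p) (X p).
have ricE i : ricci A g nabla p (E i p) (E i p) = K X1 (E i) + K X2 (E i) + K X3 (E i).
  rewrite (ricci_frame hM hg hnabla oU vE oE Up) ?sum_ord3; try exact: (vE i).1.
  by rewrite !(riemannE hM hg hnabla oU vE oE Up).
have Kdiag i : K (E i) (E i) = 0.
  have oii q : U q -> g q (E i q) (E i q) = 1.
    by move=> Uq; rewrite (oE Uq).2 eqxx.
  have := curvature_skew hM hg hnabla oU Up (vE i) (vE i) (vE i) (vE i) oii.
  by rewrite -/(K _ _) => ?; lra.
have KC i j : i != j -> K (E i) (E j) = K (E j) (E i).
  move=> /negPf ij.
  have oji q : U q -> g q (E j q) (E i q) = 0.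
    by move=> Uq; rewrite (oE Uq).2 eq_sym ij.
  rewrite /K (curvature_skew hM hg hnabla oU Up (vE i) (vE j) (vE j) (vE i) oji).
  rewrite (curvatureC hM hnabla oU Up (vE i) (vE j) (vE i)).
  rewrite (metricNl hg) ?opprK //; first exact: (curvature_tangent hM hnabla oU).
  exact: (vE j).1.
have ricX3 := ricE (1 + 1).
rewrite (scalar_curvature_frame hM hg hnabla oU vE oE Up) ricX3 sum_ord3 !ricE.
rewrite -/(K X1 X2).
have := Kdiag 0; have := Kdiag 1; have := Kdiag (1 + 1).
have := KC 0 1 erefl; have := KC 0 (1 + 1) erefl; have := KC 1 (1 + 1) erefl.
rewrite /E /= => ? ? ? ? ? ?; lra.
Qed.
End Dimension3.

(** * Almost contact metric structures *)

Section AlmostContact.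
Variables (R : realType) (M : topologicalType) (m : nat).
Variable A : set (chart R M m).
Variables (phi : M -> vec R M -> vec R M) (xi : M -> vec R M).
Variables (eta : M -> vec R M -> R) (g : M -> vec R M -> vec R M -> R).
Hypothesis hc : almost_contact_metric A phi xi eta g.
Implicit Types (u v : vec R M) (p : M).

Let hg : riemannian_metric A g := acm_metric hc.

Let txi p : tangent A p (xi p).
Proof. exact: (acm_xi hc).1. Qed.

Let tphi p u : tangent A p u -> tangent A p (phi p u).
Proof. exact: (tensor11_tangent (acm_phi hc)). Qed.

Lemma phi_linear p (a : R) u v : tangent A p u -> tangent A p v ->
  phi p (a *: u + v) = a *: phi p u + phi p v.
Proof. exact: (tensor11_linear (acm_phi hc)). Qed.

Lemma phi0 p : phi p 0 = 0.
Proof.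
have := phi_linear (-1) (@tangent0 _ _ _ A p) (@tangent0 _ _ _ A p).
by rewrite !scaleN1r !addNr.
Qed.

Lemma phiN p u : tangent A p u -> phi p (- u) = - phi p u.
Proof.
move=> tu; have := phi_linear (-1) tu (@tangent0 _ _ _ A p).
by rewrite phi0 !addr0 !scaleN1r.
Qed.

(** The square of the length of [phi xi] is [g xi xi - eta(xi)^2 = 0]. *)
Lemma phi_xi p : g p (xi p) (xi p) = 1 -> phi p (xi p) = 0.
Proof.
move=> xi1; apply/eqP; apply: contraT => phixi0.
have : 0 < g p (phi p (xi p)) (phi p (xi p)).
  by apply: (metric_pos hg) => //; exact: tphi.
by rewrite (acm_compat hc (@txi p) (@txi p)) xi1 (acm_eta_xi hc) mulr1 subrr ltxx.
Qed.

Lemma etaE p u : g p (xi p) (xi p) = 1 -> tangent A p u ->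
  eta p u = g p u (xi p).
Proof.
move=> xi1 tu; have := acm_compat hc tu (@txi p).
rewrite (acm_eta_xi hc) mulr1 phi_xi //.
by rewrite (covector0 (metric_linear hg (tphi tu))) => /eqP;
  rewrite eq_sym subr_eq0 => /eqP.
Qed.

(** Computing phi^3 u as phi^2 (phi u) and as phi (phi^2 u) leaves
    [eta (phi u) *: xi = 0]. *)
Lemma eta_phi p u : g p (xi p) (xi p) = 1 -> tangent A p u ->
  eta p (phi p u) = 0.
Proof.
move=> xi1 tu.
have eN : phi p (phi p (phi p u)) = - phi p u.
  rewrite (acm_phi2 hc tu) addrC phi_linear //; last exact: tangentN.
  by rewrite phi_xi // scaler0 add0r phiN.
have := acm_phi2 hc (tphi tu); rewrite eN -[LHS]addr0 => /addrI exi0.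
have := covector0 (metric_linearl hg (@txi p)); rewrite [in LHS]exi0.
by rewrite (metricZl hg) // xi1 mulr1.
Qed.

Lemma phi_skew p u v : g p (xi p) (xi p) = 1 ->
  tangent A p u -> tangent A p v -> g p (phi p u) v = - g p u (phi p v).
Proof.
move=> xi1 tu tv; have := acm_compat hc tu (tphi tv).
rewrite (acm_phi2 hc tv) (eta_phi xi1 tv) mulr0 subr0 => <-.
rewrite addrC (metric_linear hg (tphi tu)) //; last exact: tangentN.
rewrite (metricNr hg) //; last exact: tphi.
by rewrite -(etaE xi1 (tphi tu)) eta_phi // mulr0 add0r opprK.
Qed.
End AlmostContact.

(** * The connection and the curvature in a phi-basis *)

Section PhiBasis.
Variables (R : realType) (M : topologicalType).
Variable A : set (chart R M 3).
Hypothesis hM : smooth_manifold A.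
Variables (phi : M -> vec R M -> vec R M) (xi : M -> vec R M).
Variables (eta : M -> vec R M -> R) (g : M -> vec R M -> vec R M -> R).
Variable alpha : R.
Hypothesis hcos : almost_cosymplectic A phi xi eta g alpha.
Variable nabla : M -> vec R M -> (M -> vec R M) -> vec R M.
Hypothesis hnabla : levi_civita A g nabla.
Variables (U : set M) (e : M -> vec R M) (sigma : M -> R).
Hypothesis oU : open U.
Hypothesis hbasis : phi_basis A phi xi g U e sigma.

Let hc : almost_contact_metric A phi xi eta g := acs_contact hcos.
Let hg : riemannian_metric A g := acm_metric hc.
Let hconn : connection A nabla := lc_connection hnabla.
Let f q := phi q (e q).

Let ve : vfield A U e := pb_field hbasis.
Let vf : vfield A U f.
Proof. exact: (tensor11_smooth (acm_phi hc) oU ve). Qed.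
Let vxi : vfield A U xi.
Proof. by apply: vfield_sub (acm_xi hc). Qed.
Let te q : U q -> tangent A q (e q). Proof. exact: ve.1. Qed.
Let tf q : U q -> tangent A q (f q). Proof. exact: vf.1. Qed.
Let txi q : U q -> tangent A q (xi q). Proof. exact: vxi.1. Qed.

Let tc q X Y : U q -> vfield A U X -> vfield A U Y ->
  tangent A q (cov nabla X Y q).
Proof. by move=> Uq vX vY; exact: (conn_smooth hconn oU vX vY).1. Qed.

Let gee q : U q -> g q (e q) (e q) = 1.
Proof. by case/(pb_orthonormal hbasis). Qed.
Let gff q : U q -> g q (f q) (f q) = 1.
Proof. by case/(pb_orthonormal hbasis). Qed.
Let gxx q : U q -> g q (xi q) (xi q) = 1.
Proof. by case/(pb_orthonormal hbasis). Qed.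
Let gef q : U q -> g q (e q) (f q) = 0.
Proof. by case/(pb_orthonormal hbasis) => _ _ _ []. Qed.
Let gex q : U q -> g q (e q) (xi q) = 0.
Proof. by case/(pb_orthonormal hbasis) => _ _ _ []. Qed.
Let gfx q : U q -> g q (f q) (xi q) = 0.
Proof. by case/(pb_orthonormal hbasis) => _ _ _ []. Qed.

Let phif q : U q -> phi q (f q) = - e q.
Proof.
move=> Uq; rewrite /f (acm_phi2 hc (te Uq)) (etaE hc (gxx Uq) (te Uq)) gex //.
by rewrite scale0r addr0.
Qed.

Let gbracket X Y Z q : U q -> vfield A U X -> vfield A U Y -> vfield A U Z ->
  g q (bracket A X Y q) (Z q)
  = g q (cov nabla X Y q) (Z q) - g q (cov nabla Y X q) (Z q).
Proof.
move=> Uq vX vY vZ; rewrite -(lc_torsion_free hnabla oU vX vY Uq).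
by rewrite (metricBl hg) //; [exact: tc|exact: tc|exact: vZ.1].
Qed.

Let skew (c : R) X Y Z q : U q -> vfield A U X -> vfield A U Y -> vfield A U Z ->
  (forall q, U q -> g q (Y q) (Z q) = c) ->
  g q (cov nabla X Y q) (Z q) = - g q (cov nabla X Z q) (Y q).
Proof. by move=> Uq vX vY vZ; exact: (cov_skew hM hg hnabla oU Uq). Qed.

Let unit_cov X Y q : U q -> vfield A U X -> vfield A U Y ->
  (forall q, U q -> g q (Y q) (Y q) = 1) -> g q (cov nabla X Y q) (Y q) = 0.
Proof.
by move=> Uq vX vY Y1; have := skew Uq vX vY vY Y1 => ?; lra.
Qed.

Let vec_locally_cst X q (k : M -> R) (c : R) : U q -> vfield A U X ->
  (forall q, U q -> k q = c) -> X q k = 0.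
Proof.
move=> Uq vX kc; rewrite (tangent_eq hM (vX.1 q Uq) oU Uq kc).
exact: (tangent_cst hM c (vX.1 q Uq)).
Qed.

(** d eta (e, f) = 0 says that [bracket e f] has no component along xi. *)
Lemma cov_xi_sym q : U q ->
  g q (cov nabla e f q) (xi q) = g q (cov nabla f e q) (xi q).
Proof.
move=> Uq; apply/eqP; rewrite -subr_eq0 -gbracket //; apply/eqP.
have tb : tangent A q (bracket A e f q).
  exact: (vfield_bracket hM hnabla oU ve vf).1.
have := acs_eta hcos oU ve vf Uq; rewrite /d1 (etaE hc (gxx Uq) tb).
rewrite (vec_locally_cst (c := 0) Uq ve); last first.
  by move=> r Ur; rewrite (etaE hc (gxx Ur) (tf Ur)) gfx.
rewrite (vec_locally_cst (c := 0) Uq vf); last first.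
  by move=> r Ur; rewrite (etaE hc (gxx Ur) (te Ur)) gex.
by rewrite subrr sub0r => /eqP; rewrite oppr_eq0 => /eqP.
Qed.

(** The equation for d Phi on (e, phi e, xi): the components of Phi are
    constant, and skew-symmetry of phi turns the bracket terms into the
    divergence of xi. *)
Lemma div_xi q : U q ->
  g q (cov nabla e xi q) (e q) + g q (cov nabla f xi q) (f q) = 2 * alpha.
Proof.
move=> Uq.
have tb X Y : vfield A U X -> vfield A U Y -> tangent A q (bracket A X Y q).
  by move=> vX vY; exact: (vfield_bracket hM hnabla oU vX vY).1.
have := acs_Phi hcos oU ve vf vxi Uq.
rewrite /d2 /wedge12 /fundamental_form.
rewrite (vec_locally_cst (c := 0) Uq ve); last first.
  by move=> r Ur; rewrite phif // (metricNl hg (te Ur) (txi Ur)) gex ?oppr0.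
rewrite (vec_locally_cst (c := 0) Uq vf); last first.
  by move=> r Ur; rewrite -/(f r) gfx.
rewrite (vec_locally_cst (c := 1) Uq vxi); last first.
  by move=> r Ur; rewrite -/(f r) gff.
have xi1 := gxx Uq.
rewrite !(phi_skew hc xi1 (tb _ _ _ _)) //; try by [exact: te|exact: tf|exact: txi].
rewrite (phi_xi hc xi1) (covector0 (metric_linear hg (tb _ _ ve vf))) phif //.
rewrite -/(f q) (metricNr hg (tb _ _ ve vxi) (te Uq)) !gbracket //.
rewrite !(unit_cov Uq vxi) // !(etaE hc xi1); try by [exact: te|exact: tf|exact: txi].
rewrite gex // gfx // gff // xi1 => H; lra.
Qed.

(** Classically nabla xi = - alpha phi^2 - phi h.  The components of
    [h e = sigma e] along e and phi e give the sum of the off-diagonal entries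
    and the difference of the diagonal ones; [cov_xi_sym] and [div_xi] supply
    the two remaining linear equations. *)
Lemma cov_xi q : U q ->
  [/\ g q (cov nabla e xi q) (e q) = alpha,
      g q (cov nabla f xi q) (f q) = alpha,
      g q (cov nabla e xi q) (f q) = - sigma q &
      g q (cov nabla f xi q) (e q) = - sigma q].
Proof.
move=> Uq; have xi1 := gxx Uq; have [he _ _] := pb_h hbasis Uq.
have vb := vfield_bracket hM hnabla oU.
have tb X Y (vX : vfield A U X) (vY : vfield A U Y) := (vb X Y vX vY).1 q Uq.
have tphi u : tangent A q u -> tangent A q (phi q u).
  exact: (tensor11_tangent (acm_phi hc)).
have hE Z : vfield A U Z -> sigma q * g q (e q) (Z q) =
    2^-1 * (g q (bracket A xi f q) (Z q) + g q (bracket A xi e q) (phi q (Z q))).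
  move=> vZ; have tZ := vZ.1 q Uq.
  rewrite -(metricZl hg _ (te Uq) tZ) -he /h_tensor.
  rewrite (metricZl hg _ _ tZ); last by apply: tangentB; [exact: tb|exact/tphi/tb].
  rewrite (metricBl hg (tb _ _ vxi vf) (tphi _ (tb _ _ vxi ve)) tZ).
  by rewrite (phi_skew hc xi1 (tb _ _ vxi ve) tZ) opprK.
have := hE _ ve; have := hE _ vf; rewrite phif // -/(f q).
rewrite (metricNr hg (tb _ _ vxi ve) (te Uq)) gee // gef // !gbracket //.
rewrite !(unit_cov Uq vxi) // (skew Uq vxi ve vf gef).
have gxf r : U r -> g r (xi r) (f r) = 0.
  by move=> Ur; rewrite (Defs.metric_sym hg (txi Ur) (tf Ur)) gfx.
have gxe r : U r -> g r (xi r) (e r) = 0.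
  by move=> Ur; rewrite (Defs.metric_sym hg (txi Ur) (te Ur)) gex.
have := div_xi Uq; have := cov_xi_sym Uq.
rewrite (skew Uq ve vf vxi gfx) (skew Uq vf ve vxi gex) => *.
by split; lra.
Qed.

Variables a b : M -> R.
Hypothesis ha : forall q, U q -> a q = g q (cov nabla e f q) (e q).
Hypothesis hb : forall q, U q -> b q = - g q (cov nabla f e q) (f q).

(** The Gauss equation for the plane field orthogonal to xi.  The components
    along xi of the two products of covariant derivatives in [curvature_metric]
    give alpha^2 and sigma^2; all the other terms are intrinsic. *)
Lemma sectional_curvature p : U p ->
  g p (curvature A nabla e f f p) (e p)
  = e p b - f p a - (a p ^+ 2 + b p ^+ 2) - alpha ^+ 2 + sigma p ^+ 2.
Proof.
move=> Up; have [xee xff xef xfe] := cov_xi Up.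
have parseval := parseval3 hM hg ve vf vxi (pb_orthonormal hbasis) Up.
rewrite (curvature_metric hM hg hnabla oU Up ve vf vf ve).
have fe q : U q -> g q (f q) (e q) = 0.
  by move=> Uq; rewrite (Defs.metric_sym hg (tf Uq) (te Uq)) gef.
have bE q : U q -> g q (cov nabla f f q) (e q) = b q.
  by move=> Uq; rewrite hb // (skew Uq vf vf ve fe).
have aE q : U q -> g q (cov nabla e f q) (e q) = a q by move=> Uq; rewrite ha.
rewrite (tangent_eq hM (te Up) oU Up bE) (tangent_eq hM (tf Up) oU Up aE).
rewrite (parseval _ _ (tc Up vf vf) (tc Up ve ve)).
rewrite (parseval _ _ (tc Up ve vf) (tc Up vf ve)).
have tb : tangent A p (bracket A e f p).
  exact: (vfield_bracket hM hnabla oU ve vf).1.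
have bracketE : bracket A e f p = a p *: e p + b p *: f p.
  rewrite (frame3_expansion hM hg ve vf vxi (pb_orthonormal hbasis) Up tb).
  rewrite !gbracket // (unit_cov Up vf ve gee) (unit_cov Up ve vf gff) aE //.
  by rewrite (cov_xi_sym Up) subrr subr0 sub0r hb // scale0r addr0.
have -> : g p (cov nabla (bracket A e f) f p) (e p) = a p ^+ 2 + b p ^+ 2.
  rewrite /cov bracketE (conn_linear hconn _ oU Up (te Up) (tangentZ _ (tf Up)) vf).
  rewrite (nablaZ hnabla _ oU Up (tf Up) vf).
  rewrite (metric_linearl hg (te Up)) //; [|exact: tc|exact/tangentZ/tc].
  rewrite (metricZl hg _ (tc Up vf vf) (te Up)).
  by rewrite -/(cov nabla f f p) -/(cov nabla e f p) aE // bE.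
rewrite !(unit_cov Up) //.
rewrite (skew Up ve ve vxi gex) (skew Up vf vf vxi gfx).
rewrite (skew Up vf ve vxi gex) (skew Up ve vf vxi gfx) xee xff xef xfe.
rewrite (skew Up ve ve vf gef) aE // bE // (_ : g p (cov nabla f e p) (f p) = - b p).
  by rewrite opprK; ring.
by rewrite hb // opprK.
Qed.

Variable lambda : R.
Hypothesis hsoliton : einstein_soliton A g nabla xi lambda.

(** The soliton equation on (xi, xi), where the Lie derivative of the metric
    vanishes because xi has unit length and commutes with itself. *)
Lemma soliton_constant p : U p ->
  lambda = - g p (curvature A nabla e f f p) (e p).
Proof.
move=> Up; have := hsoliton.2 U xi xi p oU vxi vxi Up.
rewrite /lie_metric (vec_locally_cst Up vxi gxx).
have -> : bracket A xi xi p = 0.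
  by rewrite -(lc_torsion_free hnabla oU vxi vxi Up) subrr.
rewrite (covector0 (metric_linear hg (txi Up))).
rewrite (covector0 (metric_linearl hg (txi Up))) gxx // mulr1.
have := ricci_sub_scalar hM hg hnabla oU ve vf vxi (pb_orthonormal hbasis) Up.
move=> *; lra.
Qed.
End PhiBasis.

Theorem theorem3p1 (R : realType) (M : topologicalType)
  (A : set (chart R M 3))
  (phi : M -> vec R M -> vec R M) (xi : M -> vec R M)
  (eta : M -> vec R M -> R) (g : M -> vec R M -> vec R M -> R)
  (nabla : M -> vec R M -> (M -> vec R M) -> vec R M)
  (alpha lambda : R)
  (U : set M) (e : M -> vec R M) (sigma a b : M -> R)
  (hM : smooth_manifold A)
  (hcosymplectic : almost_cosymplectic A phi xi eta g alpha)
  (hnabla : levi_civita A g nabla)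
  (hsoliton : einstein_soliton A g nabla xi lambda)
  (hU : open U)
  (hbasis : phi_basis A phi xi g U e sigma)
  (ha : forall p, U p -> a p = g p (cov nabla e (fun q => phi q (e q)) p) (e p))
  (hb : forall p, U p ->
    b p = - g p (cov nabla (fun q => phi q (e q)) e p) (phi p (e p)))
  (p : M) (hp : U p) :
  let rhs := sigma p ^+ 2 - (a p ^+ 2 + b p ^+ 2)
             - phi p (e p) a + e p b in
  [/\ alpha ^+ 2 = rhs -> lambda = 0,
      alpha ^+ 2 > rhs -> lambda > 0 &
      alpha ^+ 2 < rhs -> lambda < 0].
Proof.
move=> rhs.
have lambdaE : lambda = alpha ^+ 2 - rhs.
  rewrite (soliton_constant hM hcosymplectic hnabla hU hbasis hsoliton hp).
  rewrite (sectional_curvature hM hcosymplectic hnabla hU hbasis ha hb hp) /rhs.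
  by ring.
by rewrite lambdaE subr_gt0 subr_lt0; split=> // ->; rewrite subrr.
Qed.
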